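(* Let $D$ be a finite digraph. Then: (a) there exists a quasikernel $Q$ of $D$ with $|N^+[Q]|\ge |V(D)|^{1/3}$; (b) there exists a $3$-kernel $Q$ of $D$ with $|N^+[Q]|\ge\frac{1}{3}|V(D)|$.
   Context: A set of vertices is independent if there are no arcs between two of its vertices. $\mathrm{dist}(S,v)$ is the minimum over $u\in S$ of the length of a shortest directed path from $u$ to $v$. A $q$-kernel is an independent set $Q$ with $\mathrm{dist}(Q,v)\le q$ for all $v\in V(D)$; a quasikernel is a $2$-kernel. For $S\subseteq V(D)$, $N^+[S]=S\cup\{v:\exists u\in S,\ uv\in E(D)\}$. *)

(* Defs.v *)
From mathcomp Require Import all_boot all_order all_algebra.
From mathcomp Require Import all_classical all_reals all_analysis.

Set Implicit Arguments.
Unset Strict Implicit.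
Unset Printing Implicit Defensive.

(* A finite digraph is a finite type [T] of vertices with an arbitrary arc
   relation [e]: [e u v] means that uv is an arc.  Opposite arcs uv, vu may
   both be present. *)
Section Digraph.
Variables (T : finType) (e : rel T).

(* Independence only concerns pairs of distinct vertices, so loops, if any,
   play no role; on loopless digraphs the condition [u != v] is redundant. *)
Definition independent (S : {set T}) : Prop :=
  forall u v, u \in S -> v \in S -> u != v -> ~~ e u v.

Definition dipath (u v : T) (p : seq T) : bool :=
  [&& path e u p, last u p == v & uniq (u :: p)].

(* The vertices of a directed path are distinct, so its length (number of
   arcs) is less than #|T|.  The value is +oo if no path exists. *)
Definition vdist (u v : T) : \bar int :=
  \big[Order.min/+oo%E]_(n < #|T| | [exists p : n.-tuple T, dipath u v p])
    (n%:Z)%:E.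

Definition dist (S : {set T}) (v : T) : \bar int :=
  \big[Order.min/+oo%E]_(u in S) vdist u v.

Definition qkernel (q : nat) (Q : {set T}) : Prop :=
  independent Q /\ forall v : T, (dist Q v <= (q%:Z)%:E)%E.

Definition quasikernel (Q : {set T}) : Prop := qkernel 2 Q.

Definition out_closed_nbhd (S : {set T}) : {set T} :=
  S :|: [set v | [exists u in S, e u v]].

End Digraph.

(* Main.v *)
(* Write N for the closed out-neighbourhood.  Repeatedly choosing a vertex x of
   the current set and discarding N[x] yields a set K with N[K] = V whose arcs
   all go from later to earlier choices; processing K backwards gives an
   independent Q contained in K with K contained in N[Q], hence a quasikernel.

   (a) Choose vertices with |N[x]| <= k as long as possible.  If they exhaust V
   then |N[Q]| >= |K| >= |V| / k; otherwise the remaining vertices, one of which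
   ends up in Q, all have |N[x]| > k.  Taking k about |V|^(1/2) gives the bound
   |V| <= |N[Q]|^2, which is stronger than the one claimed.

   (b) If a quasikernel Q has |N[Q]| < |V| / 3, then the complement Y of N[Q] has
   more than 2|V| / 3 vertices.  Repeatedly choosing a vertex whose out-degree is
   at least its in-degree gives an independent M in Y dominating half of Y, and
   M together with the part of Q that M does not dominate is a 3-kernel. *)
Require Import Defs.
From mathcomp Require Import all_boot all_order all_algebra.
From mathcomp Require Import all_classical all_reals all_analysis.
From mathcomp Require Import fintype finset zify lra.

Import Order.TTheory GRing.Theory Num.Theory.

Local Open Scope ring_scope.

Section Digraph.
Local Open Scope nat_scope.
Context (T : finType) (e : rel T).
Implicit Types (S W K Q Y M : {set T}) (u v x : T).

Local Notation N := (out_closed_nbhd e).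

(** * Closed out-neighbourhoods and directed distance *)

Lemma out_closed_nbhdP S v :
  reflect (v \in S \/ exists2 u, u \in S & e u v) (v \in N S).
Proof.
rewrite !inE; apply: (iffP orP).
  by case=> [|/existsP[u /andP[]]]; [left|right; exists u].
by case=> [|[u uS uv]]; [left|right; apply/existsP; exists u; rewrite uS].
Qed.

Lemma sub_out_closed_nbhd S : S \subset N S.
Proof. exact: subsetUl. Qed.

Lemma out_closed_nbhdS S1 S2 : S1 \subset S2 -> N S1 \subset N S2.
Proof.
move=> /subsetP s12; apply/subsetP => v /out_closed_nbhdP vS1.
by apply/out_closed_nbhdP; case: vS1 => [/s12|[u /s12]]; [left|right; exists u].
Qed.

Lemma in_out_closed_nbhd1 x v : (v \in N [set x]) = (v == x) || e x v.
Proof.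
apply/out_closed_nbhdP/orP.
  by case=> [/set1P->|[u /set1P->]]; [left|right].
by case=> [/eqP->|xv]; [left; rewrite inE|right; exists x; rewrite ?inE].
Qed.

Lemma iter_out_closed_nbhd_path q S v : v \in iter q N S ->
  exists u p, [/\ u \in S, path e u p, last u p = v & size p <= q].
Proof.
elim: q v => [v vS|q IHq v] /=; first by exists v, [::].
case/out_closed_nbhdP =>
    [/IHq [u [p [uS ep lp sp]]]|[w /IHq [u [p [uS ep lp sp]]] wv]].
  by exists u, p; split=> //; exact: leqW.
by exists u, (rcons p v); rewrite rcons_path ep lp wv last_rcons size_rcons.
Qed.

Lemma dist_le_iter q S v :
  v \in iter q N S -> (dist e S v <= (q%:Z)%:E)%E.
Proof.
case/iter_out_closed_nbhd_path => u [p0 [uS ep0 lp0 sp0]].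
(* Iterating [N] yields only a walk, whereas [vdist] ranges over repetition-free paths, so the walk
   is shortened. *)
have : exists p, [/\ path e u p, last u p = v, uniq (u :: p) & size p <= q].
  case: (shortenP ep0) lp0 => p ep up sub lp.
  exists p; split=> //; apply: leq_trans sp0; apply: uniq_leq_size sub.
  by case/andP: up.
case=> p [ep lp up sp].
have ltp : size p < #|T|.
  by rewrite -[(size p).+1]/(size (u :: p)) -(card_uniqP up) max_card.
apply: (@le_trans _ _ ((size p)%:Z)%:E); last by rewrite lee_fin lez_nat.
apply: (@le_trans _ _ (vdist e u v)); first by apply: bigmin_le_cond.
apply: (@bigmin_le_cond _ _ _ _ (Ordinal ltp)) => /=.
by apply/existsP; exists (in_tuple p); rewrite /dipath ep lp eqxx.
Qed.

Lemma qkernel_iter q Q :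
  independent e Q -> (forall v, v \in iter q N Q) -> qkernel e q Q.
Proof. by move=> iQ cQ; split=> // v; apply: dist_le_iter. Qed.

(** * Dominating pairs and quasikernels *)

Definition dominating_pair W K Q :=
  [/\ K \subset W, W \subset N K, Q \subset K, K \subset N Q & independent e Q].

Lemma dominating_pair_quasikernel K Q :
  dominating_pair [set: T] K Q -> quasikernel e Q.
Proof.
case=> _ VK _ KQ iQ; apply: qkernel_iter => // v /=.
by move: (subsetP VK v (in_setT v)); apply/subsetP/out_closed_nbhdS.
Qed.

Lemma independentU1 x Q : independent e Q ->
  (forall u, u \in Q -> ~~ e x u /\ ~~ e u x) -> independent e (x |: Q).
Proof.
move=> iQ xQ u v /setU1P[->|uQ] /setU1P[->|vQ]; rewrite ?eqxx //.
- by case: (xQ _ vQ).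
- by case: (xQ _ uQ).
- exact: iQ.
Qed.

(* There is no arc from [x] to [Q], so either [Q] dominates [x] or [x |: Q] is
   independent. *)
Lemma dominating_pairU1 W K Q x : x \in W ->
    dominating_pair (W :\: N [set x]) K Q ->
  exists2 Q', N Q \subset N Q' & dominating_pair W (x |: K) Q'.
Proof.
move=> xW [KW WK QK KQ iQ].
have xKW : x |: K \subset W.
  by rewrite subUset sub1set xW (subset_trans KW) ?subsetDl.
have WxK : W \subset N (x |: K).
  apply/subsetP => v vW; case vx: (v \in N [set x]).
    by move: vx; apply/subsetP/out_closed_nbhdS/subsetUl.
  have : v \in N K by apply: (subsetP WK); rewrite inE vx.
  by apply/subsetP/out_closed_nbhdS/subsetUr.
case xQ : (x \in N Q).
  exists Q => //; split=> //; first by rewrite (subset_trans QK) ?subsetUr.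
  by rewrite subUset sub1set xQ.
have QxQ : N Q \subset N (x |: Q) by apply/out_closed_nbhdS/subsetUr.
exists (x |: Q) => //; split=> //.
- exact: setUS.
- rewrite subUset sub1set (subset_trans KQ) // andbT.
  by apply: (subsetP (sub_out_closed_nbhd _)); rewrite setU11.
apply: independentU1 => // u uQ; split.
  have := subsetP KW u (subsetP QK u uQ).
  by rewrite inE in_out_closed_nbhd1 negb_or => /andP[/andP[]].
apply/negP => ux; move/negP: xQ; apply; apply/out_closed_nbhdP.
by right; exists u.
Qed.

Lemma card_setD_out_closed_nbhd1 W x : x \in W ->
  #|W :\: N [set x]| < #|W|.
Proof.
move=> xW; apply/proper_card/properP; split; first exact: subsetDl.
by exists x => //; rewrite inE in_out_closed_nbhd1 eqxx.
Qed.

Lemma dominating_pair0 : dominating_pair set0 set0 set0.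
Proof. by split; rewrite ?sub0set // => u v; rewrite inE. Qed.

Lemma dominating_pair_exists W : exists K Q, dominating_pair W K Q.
Proof.
have [m] := ubnP #|W|; elim: m W => // m IHm W leWm.
have [->|[x xW]] := set_0Vmem W.
  by exists set0, set0; exact: dominating_pair0.
have [|K [Q KQ]] := IHm (W :\: N [set x]).
  exact: leq_trans (card_setD_out_closed_nbhd1 _ _ xW) _.
by have [Q' _ KQ'] := dominating_pairU1 _ _ _ _ xW KQ; exists (x |: K), Q'.
Qed.

(* Vertices of small out-degree are chosen first: each of them puts one vertex
   in [K] and removes at most [k] vertices, and once they are exhausted any
   vertex of [Q] has a large out-neighbourhood. *)
Lemma dominating_pair_large k W : exists K Q,
  dominating_pair W K Q /\ (k < #|N Q| \/ #|W| <= #|K| * k).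
Proof.
have [m] := ubnP #|W|; elim: m W => // m IHm W leWm.
have [/existsP[x /andP[xW xk]]|/existsPn big] :=
    boolP [exists x, (x \in W) && (#|N [set x]| <= k)].
  have [|K [Q [KQ cKQ]]] := IHm (W :\: N [set x]).
    exact: leq_trans (card_setD_out_closed_nbhd1 _ _ xW) _.
  have [Q' QQ' KQ'] := dominating_pairU1 _ _ _ _ xW KQ.
  exists (x |: K), Q'; split=> //; case: cKQ => cKQ; [left|right].
    exact: leq_trans cKQ (subset_leq_card QQ').
  have xK : x \notin K.
    case: KQ => /subsetP KW _ _ _ _; apply/negP => /KW.
    by rewrite inE in_out_closed_nbhd1 eqxx.
  (* The new element [x] adds [k] to the right side, which pays for the at most [k] vertices of [W]
     in [N [set x]]. *)
  rewrite cardsU1 xK -(cardsID (N [set x])) mulnDl mul1n leq_add //.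
  by apply: leq_trans xk; apply/subset_leq_card/subsetIr.
have [K [Q KQ]] := dominating_pair_exists W; exists K, Q; split=> //.
have [W0|[x xW]] := set_0Vmem W; [right; by rewrite W0 cards0|left].
case: KQ => KW WK QK KQ _.
have [Q0|[u uQ]] := set_0Vmem Q.
  case/out_closed_nbhdP: (subsetP WK x xW) => [|[y]] /(subsetP KQ);
  by rewrite Q0 => /out_closed_nbhdP[|[z]]; rewrite inE.
have := big u; rewrite (subsetP KW) ?(subsetP QK) // -ltnNge => /leq_trans.
by apply; apply/subset_leq_card/out_closed_nbhdS; rewrite sub1set.
Qed.

Lemma quasikernel_large :
  exists2 Q, quasikernel e Q & #|T| <= #|N Q| ^ 2.
Proof.
have exk : exists k, #|T| <= k ^ 2 by exists #|T|; nia.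
(* The least number whose square reaches [#|T|] is either 0, and then [T] is empty, or [k.+1], and
   then [k] is the threshold. *)
case: (ex_minnP exk) => -[|k] Tk mink.
  have [K [Q /dominating_pair_quasikernel qQ]] := dominating_pair_exists [set: T].
  by exists Q => //; apply: leq_trans Tk _.
have [K [Q [KQ cKQ]]] := dominating_pair_large k [set: T].
exists Q; first exact: dominating_pair_quasikernel KQ.
apply: leq_trans Tk _; rewrite leq_sqr.
case: cKQ => // cTK; rewrite leqNgt; apply/negP => ltQk.
(* Since [K] lies in [N Q], it would have at most [k] elements, so [#|T| <= k * k] against
   minimality. *)
suff /mink : #|T| <= k ^ 2 by rewrite ltnn.
rewrite -cardsT (leq_trans cTK) // -mulnn leq_mul2r; apply/orP; right.
rewrite -ltnS (leq_ltn_trans _ ltQk) // ?subset_leq_card //.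
by case: KQ.
Qed.

(** * Degree counting, half-dominating sets and 3-kernels *)

Lemma sum_outdeg_indeg Y :
  \sum_(v in Y) #|[set u in Y | e v u]| = \sum_(v in Y) #|[set u in Y | e u v]|.
Proof.
under eq_bigr do rewrite -sum1dep_card big_mkcondr.
rewrite exchange_big; apply: eq_bigr => v _.
by rewrite -sum1dep_card big_mkcondr.
Qed.

Lemma outdeg_ge_indeg Y : Y != set0 ->
  exists2 v, v \in Y & #|[set u in Y | e u v]| <= #|[set u in Y | e v u]|.
Proof.
move=> /set0Pn[x xY]; apply/exists_inP; apply: contraT.
rewrite negb_exists_in => /forall_inP lt.
suff : \sum_(v in Y) #|[set u in Y | e v u]|
       < \sum_(v in Y) #|[set u in Y | e u v]| by rewrite sum_outdeg_indeg ltnn.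
rewrite (bigD1 x) //= [ltnRHS](bigD1 x) //= -addSn leq_add //.
  by rewrite ltnNge lt.
by apply: leq_sum => v /andP[vY _]; rewrite ltnW // ltnNge lt.
Qed.

(** Discarding the in-neighbours [I] of [v] too keeps the choices independent; as [#|I| <= #|O|], at
    least half of what is discarded is dominated. *)
Lemma independent_dominating_half Y : exists M,
  [/\ M \subset Y, independent e M & #|Y| <= 2 * #|N M :&: Y|].
Proof.
have [m] := ubnP #|Y|; elim: m Y => // m IHm Y leYm.
have [->|Y0] := eqVneq Y set0.
  exists set0; rewrite cards0 sub0set; split=> // u v; by rewrite inE.
have [v vY degv] := outdeg_ge_indeg Y Y0.
pose I := [set u in Y | e u v]; pose O := N [set v] :&: Y.
pose Y' := Y :\: (N [set v] :|: I).
have Y'P u : u \in Y' -> [/\ u \in Y, u \notin O, ~~ e v u & ~~ e u v].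
  rewrite in_setD in_setU in_setI in_out_closed_nbhd1 in_set.
  by case: (u == v) (u \in Y) (e v u) (e u v) => [] [] [] [].
have ltY' : #|Y'| < m.
  apply: leq_ltn_trans (leq_trans (card_setD_out_closed_nbhd1 _ _ vY) leYm).
  by apply/subset_leq_card/setDS/subsetUl.
have [M [MY' iM cM]] := IHm _ ltY'.
exists (v |: M); split.
- rewrite subUset sub1set vY; apply/subsetP => u /(subsetP MY') /Y'P.
  by case.
- by apply: independentU1 => // u /(subsetP MY') /Y'P[].
have cO : #|I| <= #|O|.
  apply: leq_trans degv _; apply/subset_leq_card/subsetP => u.
  by rewrite in_set in_setI in_out_closed_nbhd1 => /andP[-> ->]; rewrite orbT.
have cY : #|Y| <= #|Y'| + (#|O| + #|I|).
  apply: (@leq_trans #|Y' :|: (O :|: I)|).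
    apply/subset_leq_card/subsetP => u uY; rewrite !in_setU in_setD in_setU in_setI uY.
    by case: (u \in N _); case: (u \in I).
  rewrite (leq_trans (leq_card_setU _ _)) // leq_add2l.
  exact: leq_card_setU.
suff : #|O| + #|N M :&: Y'| <= #|N (v |: M) :&: Y| by lia.
(* [Y'] avoids [O], so no dominated vertex is counted twice. *)
have /eqP<- : #|O :|: (N M :&: Y')| == #|O| + #|N M :&: Y'|.
  rewrite (leq_card_setU _ _).2 disjoints_subset; apply/subsetP => u uO.
  by rewrite in_setC; apply/negP => /setIP[_ /Y'P[_ /negP]].
apply/subset_leq_card; rewrite subUset; apply/andP; split.
  by apply/setSI/out_closed_nbhdS/subsetUl.
by apply: setISS; [apply/out_closed_nbhdS/subsetUr | exact: subsetDl].
Qed.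

(* No arc leads from [Q] to [M], so after deleting from [Q] what [M] dominates
   the union with [M] is independent; distances from [Q] grow by at most 1. *)
Lemma three_kernel_extend Q M :
    independent e Q -> (forall v, v \in N (N Q)) ->
    independent e M -> [disjoint M & N Q] ->
  qkernel e 3 (M :|: Q :\: N M).
Proof.
move=> iQ cQ iM MQ; apply: qkernel_iter => [u v|v /=].
  move=> /setUP[uM|/setDP[uQ uM]] /setUP[vM|/setDP[vQ vM]] uv.
  - exact: iM.
  - by apply: contra vM => uv'; apply/out_closed_nbhdP; right; exists u.
  - apply/negP => uv'; case/negP: (disjointFr MQ vM).
    by apply/out_closed_nbhdP; right; exists u.
  - exact: iQ.
suff QM : Q \subset N (M :|: Q :\: N M).
  by have := cQ v; apply/subsetP/out_closed_nbhdS/out_closed_nbhdS.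
apply/subsetP => u uQ; case uM : (u \in N M).
  by move: uM; apply/subsetP/out_closed_nbhdS/subsetUl.
apply: (subsetP (sub_out_closed_nbhd _)).
by rewrite in_setU in_setD uM uQ orbT.
Qed.

Lemma three_kernel_large : exists2 Q, qkernel e 3 Q & #|T| <= 3 * #|N Q|.
Proof.
have [K [Q [_ TK _ KQ iQ]]] := dominating_pair_exists [set: T].
have cQ v : v \in N (N Q).
  by move: (subsetP TK v (in_setT v)); apply/subsetP/out_closed_nbhdS.
have [leTQ|ltQT] := leqP #|T| (3 * #|N Q|).
  (* A quasikernel is already a 3-kernel. *)
  exists Q => //; apply: qkernel_iter => // v.
  exact: (subsetP (sub_out_closed_nbhd _)).
have [M [MY iM cM]] := independent_dominating_half (~: N Q).
exists (M :|: Q :\: N M).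
  by apply: three_kernel_extend; rewrite // disjoints_subset.
have : #|N M :&: ~: N Q| <= #|N (M :|: Q :\: N M)|.
  apply/subset_leq_card/(subset_trans (subsetIl _ _)).
  exact/out_closed_nbhdS/subsetUl.
by have := cardsC (N Q); lia.
Qed.

End Digraph.

Lemma powR_third_le (R : realType) (m n : nat) :
  (n <= m ^ 3)%N -> n%:R `^ (1 / 3) <= m%:R :> R.
Proof.
move=> nm.
have -> : m%:R = (m ^ 3)%:R `^ (1 / 3) :> R.
  by rewrite natrX -powR_mulrn ?ler0n // -powRrM mul1r divff ?pnatr_eq0 // powRr1 ?ler0n.
by apply: ge0_ler_powR; rewrite ?nnegrE ?ler0n ?ler_nat ?divr_ge0.
Qed.

Theorem theorem2p10 (R : realType) (T : finType) (e : rel T) :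
  (exists Q : {set T}, quasikernel e Q /\
     #|T|%:R `^ (1 / 3) <= #|out_closed_nbhd e Q|%:R :> R)
  /\
  (exists Q : {set T}, qkernel e 3 Q /\
     (1 / 3) * #|T|%:R <= #|out_closed_nbhd e Q|%:R :> R).
Proof.
split.
  have [Q qQ TQ] := quasikernel_large T e; exists Q; split=> //.
  (* A natural number's square is at most its cube, also at 0. *)
  by apply: powR_third_le; apply: leq_trans TQ _; nia.
have [Q qQ] := three_kernel_large T e; rewrite -(ler_nat R) natrM => TQ.
by exists Q; split=> //; lra.
Qed.
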